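(* Let $A$ be a finite dimensional algebra over an algebraically closed field, with postprojective partition $\{\mathbf{P}_i\}_{i\in\mathbb{N}_\infty}$, and let $f:M\rightarrow N$ be an irreducible monomorphism in $\mathrm{mod}A$ with $\mathrm{tr}_{\mathbf{P}_\infty}(N)=0$. If $d_r(f)=\infty$, then $\mathrm{Coker} f$ is $\mathbf{P}_\infty$-simple.
   Context: All algebras are assumed basic. $\mathrm{mod}A$ is the category of finitely generated left $A$-modules and $\mathrm{ind}A$ is the full subcategory consisting of one representative of each isomorphism class of indecomposable modules. Postprojective partition (Auslander-Smalø): write $\mathbb{N}_\infty=\mathbb{N}\cup\{\infty\}$ with $0\in\mathbb{N}$. A postprojective partition of $A$ is a partition $\{\mathbf{P}_i\}_{i\in\mathbb{N}_\infty}$ of $\mathrm{ind}A$ such that (a) $\mathrm{ind}A$ is the disjoint union of the subcategories $\mathbf{P}_i$, $i\in\mathbb{N}_\infty$; (b) for each $j<\infty$, $\mathbf{P}_j$ is a finite minimal cover of $\bigcup_{j\le i\le\infty}\mathbf{P}_i$. Here a subcategory $\mathcal{D}\subseteq\mathcal{C}$ is a cover of $\mathcal{C}$ if every module in $\mathcal{C}$ is an epimorphic image of a module in $\mathrm{add}\,\mathcal{D}$, and it is minimal if no proper subcategory of $\mathcal{D}$ is a cover of $\mathcal{C}$. Every Artin algebra has a unique such partition. Modules in $\mathrm{add}\,\mathbf{P}$, where $\mathbf{P}=\bigcup_{0\le i<\infty}\mathbf{P}_i$, are called postprojective. The trace $\mathrm{tr}_{\mathbf{P}_i}(M)$ is the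 submodule of $M$ generated by the images of all morphisms $N\to M$ with $N\in\mathbf{P}_i$. Radical: $\mathrm{rad}(M,N)=\mathrm{rad}^1(M,N)$ is the set of $f:M\to N$ such that $gfh$ is not an isomorphism for all $h:L\to M$, $g:N\to L$ with $L$ indecomposable. For $n\ge2$, $\mathrm{rad}^n(M,N)$ is the set of $f$ of the form $f=hg$ with $g\in\mathrm{rad}(M,X)$, $h\in\mathrm{rad}^{n-1}(X,N)$ for some $X\in\mathrm{mod}A$. For $X,Y\in\mathrm{ind}A$, a morphism $f:X\to Y$ is irreducible if and only if $f\in\mathrm{rad}(X,Y)\setminus\mathrm{rad}^2(X,Y)$. Right degree (dual of Liu's left degree): for an irreducible morphism $f:X\to Y$, $d_r(f)$ is the smallest positive integer $n$ for which there exist $Z\in\mathrm{ind}A$ and $h\in\mathrm{rad}^n(Y,Z)\setminus\mathrm{rad}^{n+1}(Y,Z)$ with $hf\in\mathrm{rad}^{n+2}(X,Z)$; if there is no such $n$, $d_r(f)=\infty$. An indecomposable module $M\in\mathbf{P}_\infty$ is called $\mathbf{P}_\infty$-simple if every nontrivial (i.e. nonzero and proper) submodule of $M$ is postprojective. *)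

(* Defs.v *)
From Stdlib Require List.
From HB Require Import structures.
From mathcomp Require Import all_boot all_order all_algebra all_field.
From mathcomp Require Import ring_quotient.
From mathcomp Require Import boolp.

Set Implicit Arguments.
Unset Strict Implicit.
Unset Printing Implicit Defensive.

Import GRing.Theory.
Local Open Scope ring_scope.
Local Open Scope quotient_scope.

Inductive natinf := Fin of nat | Infty.

Definition le_natinf (i j : natinf) : bool :=
  match i, j with
  | _, Infty => true
  | Infty, Fin _ => false
  | Fin m, Fin n => (m <= n)%N
  end.

(* A class of modules, that is, a full subcategory given by its objects.
   [set (lmodType A)] would be a universe inconsistency. *)
Definition modclass (A : pzRingType) := lmodType A -> Prop.

Section Modules.
Variable A : pzRingType.
Implicit Types (L M N X Y Z : lmodType A) (C D : modclass A).

Definition fin_gen M : Prop :=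
  exists n (e : 'I_n -> M), forall x, exists a : 'I_n -> A,
    x = \sum_(i < n) a i *: e i.

Definition iso M N : Prop := exists f : {linear M -> N}, bijective f.

Definition surjective M N (f : M -> N) : Prop := forall y, exists x, f x = y.

Definition split_mono M N (f : {linear M -> N}) : Prop :=
  exists g : {linear N -> M}, cancel f g.

Definition split_epi M N (f : {linear M -> N}) : Prop :=
  exists g : {linear N -> M}, cancel g f.

Definition is_zero M : Prop := forall x : M, x = 0.

Definition direct_sum (s : seq (lmodType A)) : lmodType A :=
  foldr (fun M N => (M * N)%type : lmodType A) ('rV[A]_0 : lmodType A) s.

Definition indecomposable M : Prop :=
  ~ is_zero M /\ forall X Y, iso M (X * Y)%type -> is_zero X \/ is_zero Y.

Definition subclass C D : Prop := forall M, C M -> D M.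

Definition finite_class C : Prop :=
  exists s : seq (lmodType A), forall M, C M -> List.In M s.

Definition add D : modclass A := fun M =>
  exists s : seq (lmodType A), (forall X, List.In X s -> D X) /\
    exists M', iso (M * M')%type (direct_sum s).

Definition cover D C : Prop :=
  subclass D C /\ forall M, C M ->
    exists2 X, add D X & exists f : {linear X -> M}, surjective f.

Definition minimal_cover D C : Prop :=
  cover D C /\ forall D', subclass D' D -> ~ subclass D D' -> ~ cover D' C.

(* [ind] consists of one representative of each isomorphism class of finitely
   generated indecomposable modules. *)
Definition ind_representatives (ind : modclass A) : Prop :=
  [/\ forall M, ind M -> fin_gen M /\ indecomposable M,
      forall M, fin_gen M -> indecomposable M -> exists2 X, ind X & iso M X &
      forall M N, ind M -> ind N -> iso M N -> M = N].

(* Blocks may be empty. *)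
Definition postprojective_partition (ind : modclass A)
    (P : natinf -> modclass A) : Prop :=
  [/\ forall M, ind M <-> exists i, P i M,
      forall i j M, P i M -> P j M -> i = j &
      forall j : nat, finite_class (P (Fin j)) /\
        minimal_cover (P (Fin j))
          (fun M => exists2 i, le_natinf (Fin j) i & P i M)].

Definition postprojective (P : natinf -> modclass A) : modclass A :=
  add (fun M => exists n, P (Fin n) M).

Definition trace D M : {pred M} :=
  [pred x | `[< forall U : submodClosed M,
    (forall X, D X -> forall (h : {linear X -> M}) y, h y \in U) -> x \in U >]].

Definition rad M N (f : {linear M -> N}) : Prop :=
  forall L (h : {linear L -> M}) (g : {linear N -> L}),
    fin_gen L -> indecomposable L -> ~ bijective (g \o f \o h).

(* By convention rad^0 consists of all morphisms. *)
Fixpoint rad_pow (n : nat) M N (f : {linear M -> N}) : Prop :=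
  match n with
  | 0 => True
  | 1 => rad f
  | m.+1 => exists X (g : {linear M -> X}) (h : {linear X -> N}),
      [/\ fin_gen X, rad g, rad_pow m h & f =1 h \o g]
  end.

Definition irreducible_morphism M N (f : {linear M -> N}) : Prop :=
  [/\ ~ split_mono f, ~ split_epi f &
      forall X (g : {linear M -> X}) (h : {linear X -> N}),
        fin_gen X -> f =1 h \o g -> split_mono g \/ split_epi h].

Definition right_degree_cond X Y (f : {linear X -> Y}) (n : nat) : Prop :=
  (0 < n)%N /\ exists Z (h : {linear Y -> Z}),
    [/\ fin_gen Z, indecomposable Z,
        rad_pow n h, ~ rad_pow n.+1 h & rad_pow n.+2 (h \o f)].

Definition right_degree X Y (f : {linear X -> Y}) : natinf :=
  match pselect (exists n, `[< right_degree_cond f n >]) with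
  | left ex => Fin (ex_minn ex)
  | right _ => Infty
  end.

Section Submodule.
Variables (M : lmodType A) (U : submodClosed M).

Definition submod := {x : M | x \in U}.

HB.instance Definition _ := Choice.on submod.
HB.instance Definition _ := SubChoice.on submod.

Fact submod_subproof : subsemimod_closed [pred x : M | x \in U].
Proof.
by split=> [|a x]; [split=> [|x y]|]; rewrite !inE;
  [exact: rpred0|exact: rpredD|exact: rpredZ].
Qed.

HB.instance Definition _ :=
  GRing.SubChoice_isSubLmodule.Build A M _ submod submod_subproof.

End Submodule.

Section Cokernel.
Variables (M N : lmodType A) (f : {linear M -> N}).

Definition im : {pred N} := [pred y | `[< exists x, f x = y >]].

Fact im_submod_closed : submod_closed im.
Proof.
split=> [|a u v /asboolP[x <-] /asboolP[y <-]].
  by apply/asboolP; exists 0; rewrite raddf0.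
by apply/asboolP; exists (a *: x + y); rewrite linearP.
Qed.

HB.instance Definition _ :=
  GRing.isSubmodClosed.Build A N im im_submod_closed.

Fact im_oppr_closed : oppr_closed im.
Proof. by move=> x imx; rewrite -scaleN1r rpredZ. Qed.

HB.instance Definition _ := GRing.isOppClosed.Build N im im_oppr_closed.

Definition coker := Quotient.quot im.

HB.instance Definition _ := GRing.Zmodule.on coker.

Definition coker_scale (a : A) : coker -> coker := lift_op1 coker ( *:%R a).

Fact pi_coker_scale a (x : N) :
  coker_scale a (\pi_coker x) = \pi_coker (a *: x).
Proof.
unlock coker_scale; apply/eqP; rewrite -Quotient.idealrBE.
by rewrite -scalerBr rpredZ // Quotient.idealrBE reprK.
Qed.

Fact coker_scaleA a b (x : coker) :
  coker_scale a (coker_scale b x) = coker_scale (a * b) x.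
Proof. by rewrite -[x]reprK !pi_coker_scale scalerA. Qed.

Fact coker_scale1 : left_id 1 coker_scale.
Proof. by move=> x; rewrite -[x]reprK pi_coker_scale scale1r. Qed.

Fact coker_scaleDr : right_distributive coker_scale +%R.
Proof.
move=> a x y; rewrite -[x]reprK -[y]reprK -raddfD !pi_coker_scale.
by rewrite -raddfD scalerDr.
Qed.

Fact coker_scaleDl (x : coker) :
  {morph coker_scale^~ x : a b / a + b}.
Proof.
by move=> a b; rewrite -[x]reprK !pi_coker_scale -raddfD scalerDl.
Qed.

HB.instance Definition _ := GRing.Zmodule_isLmodule.Build A coker
  coker_scaleA coker_scale1 coker_scaleDr coker_scaleDl.

End Cokernel.

(* Membership in a subcategory of [ind] is up to isomorphism, since [ind] only
   contains chosen representatives. *)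
Definition Pinf_simple (P : natinf -> modclass A) M : Prop :=
  [/\ indecomposable M,
      exists2 X, P Infty X & iso M X &
      forall U : submodClosed M,
        (exists2 x, x \in U & x != 0) -> (exists x, x \notin U) ->
        postprojective P (submod U)].

(* The regular module is a direct sum of pairwise nonisomorphic
   indecomposable modules. *)
Definition basic : Prop :=
  exists s : seq (lmodType A),
    [/\ forall X, List.In X s -> indecomposable X,
        List.ForallOrdPairs (fun X Y => ~ iso X Y) s &
        iso A^o (direct_sum s)].

End Modules.

Arguments trace {A} D M.

(* Main.v *)
(* Let [pi : N -> C] be the projection onto the cokernel of [f].  Irreducibility
   of [f] makes every nonsurjective morphism into [C] lift through [pi].  Hence
   [C] is indecomposable and its proper submodules embed in [N], so none of
   their summands lies in [P Infty]; also, no nonsurjective morphism from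
   [P Infty] to [C] is nonzero.  As [pi \o f = 0] and [f] has infinite right
   degree, [pi] lies in every power of the radical.

   If [C] were in a finite block, it would be splitting projective in the
   corresponding tail of the partition, so it would receive no nonzero morphism
   from [P Infty] at all.  The traces in [C] of the tails then decrease to [0]:
   a nonzero stable value would have a summand generated by all tails, hence in
   [P Infty].  So only finitely many indecomposables map nontrivially to [C],
   and the Harada-Sai lemma shows that a high power of the radical vanishes on
   [C], contradicting [pi <> 0]. *)
From HB Require Import structures.
Require Import Defs.
From mathcomp Require Import all_boot all_order all_algebra all_field.
From mathcomp Require Import ring_quotient.
From mathcomp Require Import boolp.
Import Defs.

Set Implicit Arguments.
Unset Strict Implicit.
Unset Printing Implicit Defensive.

Import GRing.Theory.
Local Open Scope ring_scope.
Local Open Scope quotient_scope.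

(** * Linear maps, binary products and finite direct sums *)

Section LinearMaps.
Variable A : pzRingType.
Implicit Types (L M N X Y Z : lmodType A) (C D : modclass A).

Definition mklin M N (f : M -> N) (f_lin : linear f) : {linear M -> N} :=
  HB.pack f (GRing.isLinear.Build A M N _ f f_lin).

Lemma surj_inj_bij M N (f : M -> N) :
  surjective f -> injective f -> bijective f.
Proof.
move=> /choice[g gK] f_inj; exists g => // x.
by apply: f_inj; rewrite gK.
Qed.

Lemma bij_surj M N (f : M -> N) : bijective f -> surjective f.
Proof. by case=> g _ fK y; exists (g y). Qed.

Lemma linear_inverse M N (f : {linear M -> N}) :
  bijective f -> exists g : {linear N -> M}, cancel f g /\ cancel g f.
Proof.
case=> g fK gK.
have g_lin : linear g by move=> a u v; apply: (can_inj fK); rewrite linearP !gK.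
by exists (mklin g_lin).
Qed.

Lemma not_injectiveP M N (f : {linear M -> N}) :
  ~ injective f -> exists2 x, x != 0 & f x = 0.
Proof.
move=> f_ninj; apply: contrapT => f_ker; apply: f_ninj => x y fxy.
apply/eqP; rewrite -subr_eq0; apply: contrapT => /negP xy.
by apply: f_ker; exists (x - y); rewrite // linearB fxy subrr.
Qed.

Lemma lin_inl_linear X Y : linear (fun x : X => (x, 0) : (X * Y)%type).
Proof. by move=> a u v; congr pair; rewrite /= scaler0 addr0. Qed.
Definition lin_inl X Y := mklin (@lin_inl_linear X Y).

Lemma lin_inr_linear X Y : linear (fun y : Y => (0, y) : (X * Y)%type).
Proof. by move=> a u v; congr pair; rewrite /= scaler0 addr0. Qed.
Definition lin_inr X Y := mklin (@lin_inr_linear X Y).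

Lemma pair_inlD X Y (z : (X * Y)%type) : z = lin_inl X Y z.1 + lin_inr X Y z.2.
Proof. by case: z => x y; congr pair; rewrite /= ?addr0 ?add0r. Qed.

Lemma lin_pair_linear L X Y (f : {linear L -> X}) (g : {linear L -> Y}) :
  linear (fun x => (f x, g x) : (X * Y)%type).
Proof. by move=> a u v; congr pair; rewrite linearP. Qed.
Definition lin_pair L X Y (f : {linear L -> X}) (g : {linear L -> Y}) :=
  mklin (lin_pair_linear f g).

Lemma lin_copair_linear L X Y (f : {linear X -> L}) (g : {linear Y -> L}) :
  linear (fun z : (X * Y)%type => f z.1 + g z.2).
Proof.
by move=> a [u u'] [v v'] /=; rewrite !linearP scalerDr addrACA.
Qed.
Definition lin_copair L X Y (f : {linear X -> L}) (g : {linear Y -> L}) :=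
  mklin (lin_copair_linear f g).

Lemma iso_refl M : iso M M.
Proof. by exists idfun; exists id. Qed.

Lemma iso_sym M N : iso M N -> iso N M.
Proof. by case=> f /linear_inverse[g [fK gK]]; exists g; exists f. Qed.

Lemma iso_trans M N L : iso M N -> iso N L -> iso M L.
Proof. by case=> f f_bij [g g_bij]; exists (g \o f); exact: bij_comp. Qed.

Lemma iso_prod M M' N N' :
  iso M M' -> iso N N' -> iso (M * N)%type (M' * N')%type.
Proof.
case=> f /linear_inverse[f' [fK f'K]] [g /linear_inverse[g' [gK g'K]]].
exists (lin_pair (f \o fst) (g \o snd)).
by exists (fun z => (f' z.1, g' z.2)) => -[x y] /=; rewrite ?fK ?gK ?f'K ?g'K.
Qed.

Lemma iso_prod0 M N : is_zero N -> iso (M * N)%type M.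
Proof.
move=> N0; exists fst; exists (lin_inl M N) => // -[x y] /=.
by rewrite (N0 y).
Qed.

Lemma iso_0prod M N : is_zero N -> iso (N * M)%type M.
Proof.
move=> N0; exists snd; exists (lin_inr N M) => // -[x y] /=.
by rewrite (N0 x).
Qed.

Lemma iso_prodA L M N : iso (L * (M * N))%type ((L * M) * N)%type.
Proof.
exists (lin_pair (lin_pair fst (fst \o snd)) (snd \o snd)).
by exists (fun z => (z.1.1, (z.1.2, z.2))) => [[x [y z]]|[[x y] z]].
Qed.

Lemma iso_zero M N : is_zero M -> is_zero N -> iso M N.
Proof.
by move=> M0 N0; exists \0; exists (fun _ => 0) => x; [rewrite (M0 x)|rewrite (N0 x)].
Qed.

Lemma is_zero_direct_sum_nil : is_zero (direct_sum [::] : lmodType A).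
Proof. by move=> x; apply/rowP => -[]. Qed.

Lemma direct_sum_cat (s t : seq (lmodType A)) :
  iso (direct_sum s * direct_sum t)%type (direct_sum (s ++ t)).
Proof.
elim: s => [|X s IHs] /=; first exact: iso_0prod is_zero_direct_sum_nil.
apply: iso_trans (iso_prod (iso_refl X) IHs).
exact/iso_sym/iso_prodA.
Qed.

Lemma direct_sum1 X : iso X (direct_sum [:: X]).
Proof. by apply: iso_sym; apply: iso_prod0 is_zero_direct_sum_nil. Qed.

Lemma direct_sum_retract (s : seq (lmodType A)) X : List.In X s ->
  exists (i : {linear X -> direct_sum s}) (p : {linear direct_sum s -> X}),
    cancel i p.
Proof.
elim: s => [//|Y s IHs] /= [->|/IHs[i [p ipK]]].
  by exists (lin_inl _ _), fst.
by exists (lin_inr _ _ \o i), (p \o snd) => x /=; rewrite ipK.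
Qed.

Lemma direct_sum_component (s : seq (lmodType A)) M (h : {linear direct_sum s -> M}) x :
  h x <> 0 -> exists X, List.In X s /\
    exists (i : {linear X -> direct_sum s}) (p : {linear direct_sum s -> X}),
      cancel i p /\ h (i (p x)) <> 0.
Proof.
elim: s h x => [|Y s IHs] /= h x hx.
  by case: hx; rewrite (is_zero_direct_sum_nil x) linear0.
case: (pselect (h (lin_inl Y _ x.1) = 0)) => [hx1|hx1]; last first.
  exists Y; split; first by left.
  by exists (lin_inl _ _), fst.
have hx2 : (h \o lin_inr Y (direct_sum s)) x.2 <> 0.
  by move=> /= hx2; apply: hx; rewrite (pair_inlD x) linearD hx1 hx2 addr0.
have [X [Xs [i [p [ipK hip]]]]] := IHs _ _ hx2.
exists X; split; first by right.
by exists (lin_inr _ _ \o i), (p \o snd); split => // y /=; rewrite ipK.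
Qed.

(** * Submodules, split summands and traces *)

Definition psub M (S : M -> Prop) : {pred M} := [pred x | `[< S x >]].

Lemma psub_closed M (S : M -> Prop) :
  S 0 -> (forall a u v, S u -> S v -> S (a *: u + v)) -> submod_closed (psub S).
Proof.
move=> S0 SP; split=> [|a u v /asboolP Su /asboolP Sv]; apply/asboolP => //.
exact: SP.
Qed.

Definition mksub M (S : M -> Prop) (S0 : S 0)
    (SP : forall a u v, S u -> S v -> S (a *: u + v)) : submodClosed M :=
  HB.pack (psub S : M -> bool)
    (GRing.isSubmodClosed.Build A M (psub S) (psub_closed S0 SP)).

Lemma mksubE M (S : M -> Prop) S0 SP x : x \in @mksub M S S0 SP <-> S x.
Proof. by split => [/asboolP|Sx] //; apply/asboolP. Qed.

Section Inclusion.
Variables (M : lmodType A) (U : submodClosed M).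

(* The sigma type keeps [/=] from unfolding [incl]. *)
Lemma incl_subproof : {i : {linear submod U -> M} | forall x, i x = val x}.
Proof.
have val_lin : linear (fun x : submod U => val x) by [].
by exists (mklin val_lin).
Qed.
Definition incl := sval incl_subproof.

Lemma inclE x : incl x = val x. Proof. exact: (svalP incl_subproof). Qed.

Lemma incl_inj : injective incl.
Proof. by move=> x y; rewrite !inclE => /val_inj. Qed.

Lemma incl_in x : incl x \in U. Proof. by rewrite inclE; exact: valP. Qed.

Lemma corestrict L (f : {linear L -> M}) : (forall x, f x \in U) ->
  exists g : {linear L -> submod U}, forall x, incl (g x) = f x.
Proof.
move=> fU; pose g x : submod U := Sub (f x) (fU x).
have gE x : incl (g x) = f x by rewrite inclE SubK.
have g_lin : linear g.
  by move=> a u v; apply: incl_inj; rewrite linearP !gE linearP.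
by exists (mklin g_lin).
Qed.

End Inclusion.

Arguments incl {M U}.
Arguments incl_inj {M U}.

Lemma image_factor M N (f : {linear M -> N}) :
  exists (U : submodClosed N) (g : {linear M -> submod U}),
    [/\ surjective g, forall x, incl (g x) = f x
      & forall y, y \in U <-> exists x, f x = y].
Proof.
pose S y := exists x, f x = y.
have S0 : S 0 by exists 0; rewrite linear0.
have SP a u v : S u -> S v -> S (a *: u + v).
  by case=> x <- [y <-]; exists (a *: x + y); rewrite linearP.
pose U := mksub S0 SP.
have fU x : f x \in U by apply/mksubE; exists x.
have [g gE] := corestrict fU.
exists U, g; split => // [y|y]; last exact: mksubE.
have /mksubE[x fx] := incl_in y.
by exists x; apply: incl_inj; rewrite gE.
Qed.

(** The retraction makes [X] the direct sum of the image of [i] and the kernel of [p], so that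
    kernel must vanish. *)
Lemma indecomposable_split Z X (i : {linear Z -> X}) (p : {linear X -> Z}) :
  indecomposable X -> ~ is_zero Z -> cancel i p -> bijective i.
Proof.
move=> [_ X_ind] Zn0 ipK.
pose S x := p x = 0.
have S0 : S 0 by rewrite /S linear0.
have SP a u v : S u -> S v -> S (a *: u + v).
  by rewrite /S linearP => -> ->; rewrite scaler0 addr0.
pose K := mksub S0 SP.
have KE x : x - i (p x) \in K.
  by apply/mksubE; rewrite /S linearB ipK subrr.
have q_lin : linear (fun x => x - i (p x)).
  by move=> a u v; rewrite !linearP scalerDr addrACA.
have [q qE] := @corestrict _ K _ (mklin q_lin) KE.
have : iso X (Z * submod K)%type.
  exists (lin_pair p q); exists (fun z => i z.1 + incl z.2) => [x|[z y]] /=.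
    by rewrite qE /= addrC subrK.
  have /mksubE yK := incl_in y; rewrite /S in yK.
  have pE : p (i z + incl y) = z by rewrite linearD ipK yK addr0.
  congr pair => //; apply: incl_inj; rewrite qE /= pE.
  by rewrite addrAC subrr add0r.
case/X_ind => [//|K0].
exists p => // x; apply/eqP; rewrite eq_sym -subr_eq0.
have [y yE] : exists y : submod K, incl y = x - i (p x).
  by exists (q x); rewrite qE.
by rewrite -yE (K0 y) linear0.
Qed.

(** The trace as a set of finite sums of images, which permits induction on the sums; [trace] is an
    intersection of submodules instead. *)
Inductive tr D M : M -> Prop :=
| tr0 : tr D 0
| trD X (h : {linear X -> M}) y x : D X -> tr D x -> tr D (h y + x).

Lemma tr_add D M (x y : M) : tr D x -> tr D y -> tr D (x + y).
Proof.
elim=> [|X h z {}x DX _ IH] Dy; first by rewrite add0r.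
by rewrite -addrA; apply: trD => //; exact: IH.
Qed.

Lemma tr_gen D M X (h : {linear X -> M}) y : D X -> tr D (h y).
Proof. by move=> DX; rewrite -[h y]addr0; apply: trD => //; exact: tr0. Qed.

Lemma tr_lin D M a (x y : M) : tr D x -> tr D y -> tr D (a *: x + y).
Proof.
move=> Dx Dy; apply: tr_add => //.
elim: Dx => [|X h z {}x DX _ IH]; first by rewrite scaler0; exact: tr0.
by rewrite scalerDr -linearZ; apply: trD.
Qed.

Lemma tr_map D M N (g : {linear M -> N}) x : tr D x -> tr D (g x).
Proof.
elim=> [|X h z {}x DX _ IH]; first by rewrite linear0; exact: tr0.
by rewrite linearD; apply: (@trD _ _ _ (g \o h)).
Qed.

Lemma tr_trans C D M (x : M) :
  (forall X (y : X), C X -> tr D y) -> tr C x -> tr D x.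
Proof.
move=> CD; elim=> [|X h z {}x CX _ IH]; first exact: tr0.
by apply: tr_add => //; apply: tr_map; exact: CD.
Qed.

Lemma tr_sub C D M (x : M) : subclass C D -> tr C x -> tr D x.
Proof. by move=> CD; apply: tr_trans => X y /CD; apply: (@tr_gen _ _ _ idfun). Qed.

Definition trsub D M : submodClosed M :=
  mksub (tr0 D M) (@tr_lin D M).

Lemma tr_direct_sum D (s : seq (lmodType A)) M (h : {linear direct_sum s -> M}) x :
  (forall X, List.In X s -> D X) -> tr D (h x).
Proof.
elim: s h x => [|X s IHs] h x sD.
  by rewrite (is_zero_direct_sum_nil x) linear0; exact: tr0.
rewrite (pair_inlD x) linearD; apply: (@trD _ _ _ (h \o lin_inl _ _)).
  by apply: sD; left.
by apply: (IHs (h \o lin_inr _ _)) => Y sY; apply: sD; right.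
Qed.

Lemma cover_tr D C M (x : M) : cover D C -> C M -> tr D x.
Proof.
case=> _ DC /DC[X [s [sD [X' [u /linear_inverse[v [uK vK]]]]]] [f /(_ x)[y <-]]].
have -> : f y = (f \o (fst \o v)) (u (y, 0)) by rewrite /= uK.
exact: tr_direct_sum.
Qed.

Lemma tr_image D M (x : M) : tr D x ->
  exists s : seq (lmodType A), (forall X, List.In X s -> D X) /\
    exists (h : {linear direct_sum s -> M}) y, h y = x.
Proof.
elim=> [|X h y {}x DX _ [s [sD [g [z <-]]]]].
  by exists [::]; split => //; exists \0, 0.
exists (X :: s); split=> [Y [<-|/sD]|] //.
by exists (lin_copair h g), (y, z).
Qed.

(** Converse of [cover_tr]: by induction on the number of generators of [M], finitely many members
    of [D] already reach all of them. *)
Lemma tr_cover D M : fin_gen M -> (forall x : M, tr D x) ->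
  exists2 X, add D X & exists f : {linear X -> M}, surjective f.
Proof.
case=> n [e eM] Dtr.
have [s [sD [h hE]]] : exists s : seq (lmodType A), (forall X, List.In X s -> D X) /\
    exists h : {linear direct_sum s -> M}, forall i, exists y, h y = e i.
  elim: n e {eM} => [|n IHn] e.
    by exists [::]; split => //; exists \0 => -[].
  have [s [sD [h hE]]] := IHn (fun i => e (lift ord0 i)).
  have [t [tD [g [y gE]]]] := tr_image (Dtr (e ord0)).
  have [u /linear_inverse[v [uK vK]]] := direct_sum_cat t s.
  exists (t ++ s); split.
    by move=> X Xts; have [/tD|/sD] := List.in_app_or _ _ _ Xts.
  exists (lin_copair g h \o v) => i; case: (unliftP ord0 i) => [j ->|->].
    have [z hz] := hE j; exists (u (0, z)).
    by rewrite /= uK /= linear0 add0r.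
  by exists (u (y, 0)); rewrite /= uK /= linear0 addr0.
exists (direct_sum s).
  exists s; split => //; exists (direct_sum [::]).
  exact/iso_prod0/is_zero_direct_sum_nil.
exists h => x; have [a ->] := eM x.
have [y yE] := choice hE.
exists (\sum_i a i *: y i); rewrite linear_sum.
by apply: eq_bigr => i _; rewrite linearZ yE.
Qed.

End LinearMaps.

Arguments incl {A M U}.
Arguments incl_inj {A M U}.

(** * Dimension bounds over the ground field *)

Section Dimension.
Variables (k : fieldType) (A : falgType k).
Implicit Types (C L M N X Y Z : lmodType A).

(** Modules carry only their [A]-action, so a scalar [c] acts as [c%:A]. *)
Definition klinear n M (phi : 'rV[k]_n -> M) : Prop :=
  forall c u v, phi (c *: u + v) = (c%:A : A) *: phi u + phi v.

(** A surjection from row vectors bounds the dimension without equipping [M] with a vector space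
    structure. *)
Definition dim_le M n : Prop :=
  exists2 phi : 'rV[k]_n -> M, klinear phi & forall x, exists v, phi v = x.

Lemma klinear0 n M (phi : 'rV[k]_n -> M) : klinear phi -> phi 0 = 0.
Proof.
move=> /(_ 1 0 0); rewrite scaler0 addr0 !scale1r -{1}[phi 0]addr0.
by move/addrI.
Qed.

Lemma klinear_mulmx m n M (phi : 'rV[k]_n -> M) (B : 'M_(m, n)) :
  klinear phi -> klinear (fun v => phi (v *m B)).
Proof. by move=> phi_lin c u v; rewrite mulmxDl -scalemxAl phi_lin. Qed.

Lemma klinear_comp n M N (phi : 'rV[k]_n -> M) (f : {linear M -> N}) :
  klinear phi -> klinear (fun v => f (phi v)).
Proof. by move=> phi_lin c u v; rewrite phi_lin linearP. Qed.

Lemma dim_le_surj M L n (f : {linear M -> L}) :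
  dim_le M n -> surjective f -> dim_le L n.
Proof.
move=> [phi phi_lin phiM] fM; exists (fun v => f (phi v)).
  exact: klinear_comp.
by move=> y; have [x <-] := fM y; have [v <-] := phiM x; exists v.
Qed.

Lemma dim_le_iso M L n : iso M L -> dim_le M n -> dim_le L n.
Proof. by case=> f /bij_surj f_surj /dim_le_surj; apply. Qed.

Lemma dim_le_leq M m n : (m <= n)%N -> dim_le M m -> dim_le M n.
Proof.
move=> le_mn [phi phi_lin phiM].
exists (fun v => phi (v *m pid_mx m)); first exact: klinear_mulmx.
move=> x; have [v <-] := phiM x; exists (v *m pid_mx m).
by rewrite -mulmxA mul_pid_mx minnn (minn_idPr le_mn) pid_mx_1 mulmx1.
Qed.

Lemma dim_le0 M : dim_le M 0 -> is_zero M.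
Proof.
by move=> [phi phi_lin phiM] x; have [v <-] := phiM x; rewrite thinmx0 klinear0.
Qed.

(** A preimage [v] of a nonzero kernel element spans a line that dies in [L], so a complement of
    [v], of rank [n.-1], still surjects onto [L]. *)
Lemma dim_le_proper_quotient M L n (f : {linear M -> L}) :
  dim_le M n -> surjective f -> ~ injective f ->
  exists2 d, n = d.+1 & dim_le L d.
Proof.
move=> [phi phi_lin phiM] fM /not_injectiveP[x x_neq0 fx].
have [v vx] := phiM x.
have v_neq0 : v != 0.
  by apply: contraNneq x_neq0 => v0; rewrite -vx v0 klinear0.
have rank_compl : \rank (v^C)%MS = n.-1.
  by rewrite mxrank_compl rank_rV v_neq0 subn1.
exists n.-1.
  case: n v v_neq0 {phi phi_lin phiM vx rank_compl} => // v.
  by rewrite thinmx0 eqxx.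
rewrite -rank_compl; exists (fun w => f (phi (w *m row_base (v^C)%MS))).
  exact/klinear_comp/klinear_mulmx.
move=> y; have [z <-] := fM y; have [u <-] := phiM z.
have /sub_addsmxP[[a b] /= ->] : (u <= v + v^C)%MS.
  by rewrite submx_full // addsmx_compl_full.
have /submxP[w ->] : (b *m v^C <= row_base (v^C))%MS.
  by rewrite eq_row_base submxMl.
exists w; rewrite [a]mx11_scalar mul_scalar_mx phi_lin linearP vx.
by rewrite fx scaler0 add0r.
Qed.

(** A matrix of maximal rank with row space inside [S] works: adjoining an element of [S] outside
    the row space would raise the rank. *)
Lemma subspace_rowspace n (S : 'rV[k]_n -> Prop) :
  S 0 -> (forall c u v, S u -> S v -> S (c *: u + v)) ->
  exists B : 'M_n, forall v, S v <-> (v <= B)%MS.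
Proof.
move=> S0 SP.
pose Q r := `[< exists B : 'M[k]_n, \rank B = r /\
                 forall v : 'rV_n, (v <= B)%MS -> S v >].
have Q0 : exists r, Q r.
  exists 0%N; apply/asboolP; exists 0; split; first exact: mxrank0.
  by move=> v /submx0null ->.
have Qn r : Q r -> (r <= n)%N by move=> /asboolP[B [<- _]]; exact: rank_leq_col.
case: (ex_maxnP Q0 Qn) => r /asboolP[B [rB BS]] r_max.
exists B => v; split=> [Sv|]; last exact: BS.
have : Q (\rank (B + v)%MS).
  apply/asboolP; exists (B + v)%MS; split=> // u /sub_addsmxP[[b a] /= ->].
  rewrite [a]mx11_scalar mul_scalar_mx addrC; apply: SP => //.
  by apply: BS; exact: submxMl.
move/r_max; rewrite -rB => le_rank.
have [le_rank' /esym] := mxrank_leqif_sup (addsmxSl B v).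
by rewrite eqn_leq le_rank' le_rank addsmx_sub => /andP[].
Qed.

(** The preimage under [phi] of the image of [i] is a row space. Its rank is the bound [r], and full
    rank means that [i] reaches everything. *)
Lemma dim_le_embedding_rank L M n (i : {linear L -> M}) :
  dim_le M n -> injective i ->
  exists r, [/\ dim_le L r, (r <= n)%N & r = n -> surjective i].
Proof.
move=> [phi phi_lin phiM] i_inj.
pose S v := exists l, i l = phi v.
have [||B BP] := @subspace_rowspace n S.
- by exists 0; rewrite linear0 klinear0.
- move=> c u v [x ix] [y iy]; exists ((c%:A : A) *: x + y).
  by rewrite phi_lin linearP ix iy.
have /choice[g gE] (w : 'rV_(\rank B)) : S (w *m row_base B).
  by apply/BP; rewrite (submx_trans (submxMl _ _)) // eq_row_base.
exists (\rank B); split; last 1 first.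
- move=> rankB x; have [v <-] := phiM x; apply/BP.
  by rewrite submx_full // /row_full rankB.
- exists g => [c u v|l].
    by apply: i_inj; rewrite linearP !gE; exact: klinear_mulmx.
  have [v vl] := phiM (i l).
  have /BP vB : S v by exists l.
  have /submxP[w vw] : (v <= row_base B)%MS by rewrite eq_row_base.
  by exists w; apply: i_inj; rewrite gE -vw.
- exact: rank_leq_col.
Qed.

Lemma dim_le_inj L M n (i : {linear L -> M}) :
  dim_le M n -> injective i -> dim_le L n.
Proof.
move=> Mn i_inj; have [r [Lr le_rn _]] := dim_le_embedding_rank Mn i_inj.
exact: dim_le_leq le_rn Lr.
Qed.

Lemma dim_le_proper_sub L M n (i : {linear L -> M}) :
  dim_le M n -> injective i -> ~ surjective i ->
  exists2 d, n = d.+1 & dim_le L d.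
Proof.
move=> Mn i_inj i_nsurj.
have [r [Lr le_rn eq_rn]] := dim_le_embedding_rank Mn i_inj.
have lt_rn : (r < n)%N.
  by rewrite ltn_neqAle le_rn andbT; apply/eqP => /eq_rn.
exists n.-1; first by rewrite (ltn_predK lt_rn).
by apply: dim_le_leq Lr; rewrite -ltnS (ltn_predK lt_rn).
Qed.

(** * Finite generation and decomposition into indecomposables *)

Lemma fin_gen_dim_le M : fin_gen M -> exists n, dim_le M n.
Proof.
case=> n [e eM]; pose d := \dim {:A}; pose b := vbasis {:A}.
pose c (v : 'rV[k]_(n * d)) i : A := \sum_(j < d) vec_mx v i j *: b`_j.
have c_lin a u v i : c (a *: u + v) i = a *: c u i + c v i.
  rewrite /c scaler_sumr -big_split /=; apply: eq_bigr => j _.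
  by rewrite linearP !mxE scalerDl scalerA.
exists (n * d)%N; exists (fun v => \sum_i c v i *: e i) => [a u v|x].
  rewrite scaler_sumr -big_split /=; apply: eq_bigr => i _.
  by rewrite c_lin scalerDl scalerA mulr_algl.
have [a ->] := eM x.
exists (mxvec (\matrix_(i, j) coord b j (a i))).
apply: eq_bigr => i _; congr (_ *: _).
rewrite [RHS](coord_vbasis (memvf (a i))); apply: eq_bigr => j _.
by rewrite mxvecK mxE.
Qed.

Lemma dim_le_fin_gen M n : dim_le M n -> fin_gen M.
Proof.
move=> [phi phi_lin phiM]; exists n, (fun i => phi (delta_mx 0 i)) => x.
have [v <-] := phiM x; exists (fun i => (v 0 i)%:A).
rewrite {1}(row_sum_delta v).
elim/big_rec2: _ => [|i y u _ <-]; first exact: klinear0.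
exact: phi_lin.
Qed.

Lemma fin_gen_inj L M (i : {linear L -> M}) :
  fin_gen M -> injective i -> fin_gen L.
Proof.
by move=> /fin_gen_dim_le[n Mn] /(dim_le_inj Mn); exact: dim_le_fin_gen.
Qed.

Lemma fin_gen_surj L M (f : {linear L -> M}) :
  fin_gen L -> surjective f -> fin_gen M.
Proof.
by move=> /fin_gen_dim_le[n Ln] /(dim_le_surj Ln); exact: dim_le_fin_gen.
Qed.

(** Strong induction on the dimension bound: when both factors are nonzero, both projections have a
    kernel, so both factors get smaller bounds. *)
Lemma ind_decomposition (ind : modclass A) M :
  ind_representatives ind -> fin_gen M ->
  exists s, (forall X, List.In X s -> ind X) /\ iso M (direct_sum s).
Proof.
move=> [_ ind_iso _] /fin_gen_dim_le[n].
elim/ltn_ind: n M => n IHn M Mn.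
case: (pselect (is_zero M)) => [M0|Mn0].
  by exists [::]; split => //; exact: iso_zero M0 (@is_zero_direct_sum_nil A).
case: (pselect (indecomposable M)) => [M_ind|M_dec].
  have [X indX MX] := ind_iso _ (dim_le_fin_gen Mn) M_ind.
  exists [:: X]; split=> [Y [<-|]|] //.
  exact: iso_trans MX (direct_sum1 X).
have [X [Y [MXY [Xn0 Yn0]]]] :
    exists X Y, iso M (X * Y)%type /\ ~ is_zero X /\ ~ is_zero Y.
  apply: contrapT => noXY; apply: M_dec; split=> // X Y MXY.
  case: (pselect (is_zero X)) => [|Xn0]; first by left.
  by right; apply: contrapT => Yn0; apply: noXY; exists X, Y.
have XYn := dim_le_iso MXY Mn.
have [dX nX Xd] : exists2 d, n = d.+1 & dim_le X d.
  apply: (dim_le_proper_quotient (f := fst) XYn) => [x|fst_inj].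
    by exists (x, 0).
  by apply: Yn0 => y; have [] : (0, y) = (0, 0) :> (X * Y)%type by exact: fst_inj.
have [dY nY Yd] : exists2 d, n = d.+1 & dim_le Y d.
  apply: (dim_le_proper_quotient (f := snd) XYn) => [y|snd_inj].
    by exists (0, y).
  by apply: Xn0 => x; have [] : (x, 0) = (0, 0) :> (X * Y)%type by exact: snd_inj.
have [||s [s_ind Xs]] := IHn dX _ X; rewrite ?nX //.
have [||t [t_ind Yt]] := IHn dY _ Y; rewrite ?nY //.
exists (s ++ t); split.
  by move=> Z Zst; have [/s_ind|/t_ind] := List.in_app_or _ _ _ Zst.
apply: iso_trans MXY _; apply: iso_trans (iso_prod Xs Yt) _.
exact: direct_sum_cat.
Qed.

Lemma ind_component (ind : modclass A) M N (h : {linear M -> N}) x :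
  ind_representatives ind -> fin_gen M -> h x <> 0 ->
  exists X (i : {linear X -> M}) (p : {linear M -> X}),
    [/\ ind X, cancel i p & h (i (p x)) <> 0].
Proof.
move=> hind M_fg hx.
have [s [s_ind [u /linear_inverse[v [uK vK]]]]] := ind_decomposition hind M_fg.
have [|X [Xs [i [p [ipK hip]]]]] := @direct_sum_component _ _ _ (h \o v) (u x).
  by rewrite /= uK.
exists X, (v \o i), (p \o u); split => [|y|//]; first exact: s_ind.
by rewrite /= vK ipK.
Qed.

(** * Chains of nonisomorphisms and the Harada-Sai lemma *)

Definition rank_le d X Y (f : {linear X -> Y}) : Prop :=
  exists Z (a : {linear X -> Z}) (b : {linear Z -> Y}),
    dim_le Z d /\ forall x, f x = b (a x).

Definition bounded_ind b X : Prop := indecomposable X /\ dim_le X b.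

(** The final leg is arbitrary and [Y] is unrestricted, so that chains may end in any module. *)
Fixpoint npath b m X Y (f : {linear X -> Y}) : Prop :=
  match m with
  | 0 => True
  | m'.+1 => exists Z (g : {linear X -> Z}) (h : {linear Z -> Y}),
      [/\ bounded_ind b Z, ~ bijective g, npath b m' h & forall x, f x = h (g x)]
  end.

Lemma npath_split b m p X Y (f : {linear X -> Y}) :
  bounded_ind b X -> npath b (m + p) f ->
  exists Z (g : {linear X -> Z}) (h : {linear Z -> Y}),
    [/\ bounded_ind b Z, npath b m g, npath b p h & forall x, f x = h (g x)].
Proof.
elim: m X f => [|m IHm] X f bX; first by exists X, idfun, f.
case=> Z [g [h [bZ g_nbij hp fE]]].
have [W [g' [h' [bW g'm h'p hE]]]] := IHm _ _ bZ hp.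
exists W, (g' \o g), h'; split=> // [|x]; last by rewrite fE hE.
by exists Z, g, g'.
Qed.

(** Either [t] has a kernel and its image is a proper quotient of [Z1], or the image is a proper
    submodule of [Z2]. *)
Lemma rank_le_not_bijective d Z1 Z2 (t : {linear Z1 -> Z2}) :
  dim_le Z1 d.+1 -> dim_le Z2 d.+1 -> ~ bijective t -> rank_le d t.
Proof.
move=> Z1d Z2d t_nbij.
have [U [g [g_surj gE _]]] := image_factor t.
exists (submod U), g, incl; split=> [|x]; last by rewrite gE.
case: (pselect (injective t)) => [t_inj|t_ninj].
  have [|d' [->] //] := dim_le_proper_sub Z2d (@incl_inj _ _ U).
  move=> U_surj; apply: t_nbij; apply: surj_inj_bij => // y.
  have [u <-] := U_surj y; have [x <-] := g_surj u.
  by exists x; rewrite gE.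
have [|d' [->] //] := dim_le_proper_quotient Z1d g_surj.
by move=> g_inj; apply: t_ninj => x y txy; apply: g_inj; apply: incl_inj; rewrite !gE.
Qed.

(* Harada-Sai.  If a chain of twice the length still had rank [d + 1], both
   halves would have a common image of dimension [d + 1] through the middle
   nonisomorphism [g], splitting off both ends of [g]. *)
Lemma harada_sai_rank b j :
  exists m, forall X Y (f : {linear X -> Y}),
    bounded_ind b X -> npath b m f -> rank_le (b - j) f.
Proof.
elim: j => [|j [m IHm]].
  by exists 0%N => X Y f [_ Xb] _; exists X, idfun, f; rewrite subn0.
exists (m + m.+1)%N => X Y f bX /(npath_split bX).
case=> X' [f1 [f2 [bX' f1m [Y' [g [f3 [bY' g_nbij f3m f2E]]]] fE]]].
have [Z1 [a1 [b1 [Z1d f1E]]]] := IHm _ _ _ bX f1m.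
have [Z2 [a2 [b2 [Z2d f3E]]]] := IHm _ _ _ bY' f3m.
(* Subtraction is truncated: once [b - j] is [0] the bound no longer drops, and the factorization of
   [f1] suffices. *)
case: (posnP (b - j)) => [bj0|].
  exists Z1, a1, (f2 \o b1); split=> [|x]; last by rewrite fE f1E.
  by move: Z1d; rewrite subnS bj0.
move=> bj_gt0; rewrite subnS.
move: Z1d Z2d; rewrite -(prednK bj_gt0); set d := (b - j).-1 => Z1d Z2d /=.
pose t := a2 \o (g \o b1) : {linear Z1 -> Z2}.
have tE x : f x = b2 (t (a1 x)) by rewrite fE f2E f3E f1E.
suff [Z [a [c [Zd tE']]]] : rank_le d t.
  by exists Z, (a \o a1), (b2 \o c); split=> // x; rewrite tE tE'.
case: (pselect (is_zero Z1)) => [Z1_0|Z1n0].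
  exists Z1, idfun, t; split=> //; apply: (dim_le_leq (leq0n d)).
  by exists (fun _ => 0) => [c u v|x]; [rewrite scaler0 addr0|exists 0].
apply: rank_le_not_bijective => //.
move/linear_inverse=> [t' [tK t'K]].
have Z2n0 : ~ is_zero Z2.
  by move=> Z2_0; apply: Z1n0 => x; rewrite -[x]tK (Z2_0 (t x)) linear0.
have b1_bij : bijective b1.
  by apply: (@indecomposable_split _ _ _ b1 (t' \o (a2 \o g)) bX'.1) => // x; exact: tK.
have c_bij : bijective (g \o (b1 \o t')).
  by apply: (@indecomposable_split _ _ _ _ a2 bY'.1) => // x; exact: t'K.
have t'_bij : bijective t' by exists t.
apply: g_nbij.
have bt_bij : bijective (b1 \o t') by exact: bij_comp.
have [e btK eK] := bt_bij.
have e_bij : bijective e by exists (b1 \o t').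
apply: (eq_bij (bij_comp c_bij e_bij)) => x /=.
by congr (g _); exact: eK.
Qed.

Lemma harada_sai b :
  exists m, forall X Y (f : {linear X -> Y}),
    bounded_ind b X -> npath b m f -> forall x, f x = 0.
Proof.
have [m hm] := harada_sai_rank b b; exists m => X Y f bX /(hm _ _ _ bX).
case=> Z [a [c [Z0 fE]]] x; rewrite subnn in Z0.
by rewrite fE (dim_le0 Z0 (a x)) linear0.
Qed.

(** * Descending chains of submodules, and traces inside a submodule *)

Lemma submod_dcc M (U : nat -> submodClosed M) :
  fin_gen M -> (forall m n x, (m <= n)%N -> x \in U n -> x \in U m) ->
  exists n, forall m x, (n <= m)%N -> x \in U n -> x \in U m.
Proof.
move=> /fin_gen_dim_le[d0 Md] U_decr.
(* The index [n] attains the least dimension bound in the chain; a strictly smaller later term would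
   have a smaller bound. *)
pose Q d := `[< exists n, dim_le (submod (U n)) d >].
have Q_ex : exists d, Q d.
  by exists d0; apply/asboolP; exists 0%N; exact: dim_le_inj Md (@incl_inj _ _ _).
case: (ex_minnP Q_ex) => d /asboolP[n Und] d_min.
exists n => m x le_nm xn.
have [j jE] : exists j : {linear submod (U m) -> submod (U n)},
    forall u, incl (j u) = incl u.
  by apply: corestrict => u; apply: U_decr le_nm _; exact: incl_in.
have j_inj : injective j.
  by move=> u v juv; apply: incl_inj; rewrite -!jE juv.
case: (pselect (surjective j)) => [j_surj|j_nsurj].
  have [u ju] := j_surj (Sub x xn).
  by have := incl_in u; rewrite -jE ju inclE SubK.
have [d' dE Umd] := dim_le_proper_sub Und j_inj j_nsurj.
have /d_min : Q d' by apply/asboolP; exists m.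
by rewrite dE ltnn.
Qed.

(** Each map from [D] to [M] lands in [U], so the sum expressing [incl u] is corestricted one
    summand at a time. *)
Lemma tr_corestrict (D : modclass A) M (U : submodClosed M) (u : submod U) :
  (forall Y (h : {linear Y -> M}) y, D Y -> h y \in U) ->
  tr D (incl u) -> tr D u.
Proof.
move=> DU; move: {-2}(incl u) (erefl (incl u)) => x xE Dx.
elim: Dx u xE => [|Y h y {}x DY _ IH] u uE.
  by rewrite (_ : u = 0); [exact: tr0 | apply: incl_inj; rewrite -uE linear0].
have [g gE] := corestrict (fun y => DU Y h y DY).
rewrite -(subrK (g y) u) addrC; apply: trD => //; apply: IH.
by rewrite linearB -uE gE addrAC subrr add0r.
Qed.

(** * Powers of the radical *)

Lemma rad_comp L M N (f : {linear M -> N}) (g : {linear L -> M}) :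
  rad f -> rad (f \o g).
Proof. by move=> f_rad K h g'; exact: (f_rad K (g \o h) g'). Qed.

Lemma rad_pow_comp n L M N (f : {linear M -> N}) (g : {linear L -> M}) :
  rad_pow n f -> rad_pow n (f \o g).
Proof.
case: n => [|[|n]] //; first exact: rad_comp.
move=> [X [u [h [X_fg u_rad hn fE]]]].
exists X, (u \o g), h; split=> //; first exact: rad_comp.
by move=> x /=; rewrite fE.
Qed.

Lemma rad_not_retract X Y (g : {linear X -> Y}) (p : {linear Y -> X}) :
  fin_gen X -> indecomposable X -> rad g -> ~ bijective (p \o g).
Proof. by move=> X_fg X_ind g_rad; exact: (g_rad X idfun p). Qed.

Lemma rad0 M N : rad (\0 : {linear M -> N}).
Proof.
move=> L h g _ [L_n0 _] [u uK _]; apply: L_n0 => x.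
by rewrite -[x]uK -[RHS]uK /= !linear0.
Qed.

(** From exponent 2 on, membership is a factorization up to pointwise equality, so vanishing
    pointwise is enough. *)
Lemma rad_pow0 n M N (f : {linear M -> N}) :
  fin_gen N -> (forall x, f x = 0) -> rad_pow n.+2 f.
Proof.
move=> N_fg f0; elim: n M f f0 => [|n IHn] M f f0.
  by exists N, \0, \0; split => //; exact: rad0.
by exists N, \0, \0; split => //; [exact: rad0|exact: IHn].
Qed.

(** * Tails and blocks of the postprojective partition *)

Section Partition.
Variables (ind : modclass A) (P : natinf -> modclass A).
Hypothesis ind_reps : ind_representatives ind.
Hypothesis P_part : postprojective_partition ind P.

Definition tail n : modclass A :=
  fun M => exists2 i, le_natinf (Fin n) i & P i M.

Lemma tail_block n X : P (Fin n) X -> tail n X.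
Proof. by exists (Fin n) => //=. Qed.

Lemma tailS m n X : (m <= n)%N -> tail n X -> tail m X.
Proof.
move=> le_mn [[i|] ni Xi]; last by exists Infty.
by exists (Fin i) => //; exact: leq_trans ni.
Qed.

Lemma block_ind i X : P i X -> ind X.
Proof. by case: P_part => /(_ X)[_ indP] _ _ Xi; apply: indP; exists i. Qed.

Lemma tail_ind n X : tail n X -> ind X.
Proof. by case=> i _ /block_ind. Qed.

(* A cover-minimal block consists of splitting projectives of the tail:
   otherwise [X] could be dropped from [P n], because the contribution of the
   nonisomorphisms [X -> X] dies after finitely many iterations. *)
Lemma block_not_tr n X : P (Fin n) X ->
  ~ forall x : X, tr (fun Y => tail n Y /\ Y <> X) x.
Proof.
move=> PX trX.
have [ind_fg_ind _ ind_eq] := ind_reps.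
have [_ _ /(_ n)[_ [n_cover n_min]]] := P_part.
pose D' : modclass A := fun Z => P (Fin n) Z /\ Z <> X.
have [X_fg X_ind] := ind_fg_ind _ (block_ind PX).
have [b Xb] := fin_gen_dim_le X_fg.
have bX : bounded_ind b X by [].
have [m hs] := harada_sai b.
(* Here [p] counts the nonisomorphisms already composed into [f], and [j] those still missing before
   [hs] forces [f] to vanish. *)
have claim j p (f : {linear X -> X}) : (p + j)%N = m -> npath b p f ->
    forall x, tr D' (f x).
  elim: j p f => [|j IHj] p f pj fp x.
    by rewrite addn0 in pj; rewrite pj in fp; rewrite (hs _ _ _ bX fp) //; exact: tr0.
  elim: {x}(trX x) => [|Y t y x [nY YX] _ IHx]; first by rewrite linear0; exact: tr0.
  rewrite linearD; apply: tr_add => //.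
  elim: {y}(cover_tr y n_cover nY) => [|Z g z y PZ _ IHy].
    by rewrite !linear0; exact: tr0.
  rewrite !linearD; apply: tr_add => //.
  case: (pselect (Z = X)) => [ZX|ZX]; last first.
    by apply: (@tr_gen _ _ _ _ (f \o (t \o g))).
  subst Z; apply: (IHj p.+1 (f \o (t \o g))); first by rewrite addSnnS.
  (* If [t \o g] were invertible, [g] would split into the indecomposable [Y], hence be an
     isomorphism, and uniqueness of representatives would give [Y = X]. *)
  exists X, (t \o g), f; split=> // /linear_inverse[q [qK _]].
  apply: YX; apply: (ind_eq) (block_ind PX) _; first exact: tail_ind nY.
  apply: iso_sym; exists g.
  have [Y_fg Y_ind] := ind_fg_ind _ (tail_ind nY).
  apply: (@indecomposable_split _ _ _ g (q \o t) Y_ind X_ind.1).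
  by move=> x1; exact: qK.
have trX' (x : X) : tr D' x by apply: (claim m 0%N idfun).
(* The block without [X] still covers the tail, against minimality. *)
apply: (n_min D'); first by move=> Z [].
  by move=> /(_ X PX)[].
split=> [Z [PZ _]|Z nZ]; first exact: tail_block.
apply: tr_cover; first by have [] := ind_fg_ind _ (tail_ind nZ).
move=> z; apply: tr_trans (cover_tr z n_cover nZ) => Y y PY.
case: (pselect (Y = X)) => [YX|YX]; first by subst Y.
exact: (@tr_gen _ _ _ _ idfun).
Qed.

(** The traces of the tails stabilize. A nonzero stable value has a summand [X] mapping nontrivially
    to [C], hence in a finite block; yet later tails generate [X], against [block_not_tr]. *)
Lemma tail_maps_vanish C : fin_gen C ->
  (forall Y (h : {linear Y -> C}) y, P Infty Y -> h y = 0) ->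
  exists n, forall Y (h : {linear Y -> C}) y, tail n Y -> h y = 0.
Proof.
move=> C_fg Pinf0.
have [|n nU] := @submod_dcc C (fun n => trsub (tail n) C) C_fg.
  move=> m n x le_mn /mksubE Ux; apply/mksubE.
  by apply: tr_sub Ux => Y; exact: tailS.
exists n => Y h y nY; apply: contrapT => hy.
have hyU : h y \in trsub (tail n) C by apply/mksubE; exact: tr_gen.
have W_fg : fin_gen (submod (trsub (tail n) C)).
  exact: fin_gen_inj C_fg (@incl_inj _ _ _).
have [|X [i [p [indX ipK hX]]]] :=
    @ind_component _ _ _ incl (Sub (h y) hyU) ind_reps W_fg.
  by rewrite inclE SubK.
have [indP P_disj _] := P_part.
have [[q|] PX] := (indP X).1 indX; last first.
  by apply: hX; exact: (Pinf0 X (incl \o i)).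
apply: (block_not_tr PX) => x.
(* Above [q], so that the tail excludes [X]; at least [n], so that its trace is the stable one. *)
pose m := maxn q.+1 n.
have : tr (tail m) (i x).
  apply: tr_corestrict => [Z g z mZ|].
    by apply/mksubE; apply: tr_gen; apply: tailS mZ; exact: leq_maxr.
  by have /mksubE := nU m _ (leq_maxr _ _) (incl_in (i x)).
move/(tr_map p); rewrite ipK; apply: tr_sub => Z mZ; split.
  by apply: tailS mZ; rewrite (leq_trans (leqnSn q)) ?leq_maxl.
move=> ZX; subst Z; case: mZ => -[j|] mj Xj; have := P_disj _ _ _ PX Xj => //.
by case=> qj; move: mj; rewrite /= /m -qj geq_max ltnn.
Qed.

Lemma blocks_bounded n : exists b, forall i Y, (i < n)%N -> P (Fin i) Y -> dim_le Y b.
Proof.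
have [ind_fg_ind _ _] := ind_reps.
have list_bound (s : seq (lmodType A)) :
    exists b, forall Y, List.In Y s -> fin_gen Y -> dim_le Y b.
  elim: s => [|X s [b bs]]; first by exists 0%N.
  (* [finite_class] only asks the list to contain the block, so the list may have members that are
     not finitely generated. *)
  case: (pselect (fin_gen X)) => [/fin_gen_dim_le[c Xc]|X_nfg]; last first.
    by exists b => Y [<- //|]; exact: bs.
  exists (maxn b c) => Y [<- _|Ys Y_fg].
    by apply: dim_le_leq Xc; exact: leq_maxr.
  by apply: dim_le_leq (bs Y Ys Y_fg); exact: leq_maxl.
elim: n => [|n [b bn]]; first by exists 0%N.
have [_ _ /(_ n)[[s sP] _]] := P_part.
have [c cs] := list_bound s.
exists (maxn b c) => i Y; rewrite ltnS leq_eqVlt => /predU1P[->|lt_in] PY.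
  have [Y_fg _] := ind_fg_ind _ (block_ind PY).
  by apply: dim_le_leq (cs _ (sP _ PY) Y_fg); exact: leq_maxr.
by apply: dim_le_leq (bn _ _ lt_in PY); exact: leq_maxl.
Qed.

(** Only the value at [x] is followed: each middle term has an indecomposable summand on which the
    image of [x] survives, and the component into it is no isomorphism because the factor is
    radical. The last factor is left whole, whence [m.+1] against [m]. *)
Lemma rad_pow_npath C b m X (h : {linear X -> C}) x :
  (forall Y (g : {linear Y -> C}) y, ind Y -> g y <> 0 -> dim_le Y b) ->
  fin_gen X -> indecomposable X -> rad_pow m.+1 h -> h x <> 0 ->
  exists2 g : {linear X -> C}, npath b m g & g x <> 0.
Proof.
move=> indC; have [ind_fg_ind _ _] := ind_reps.
elim: m X h x => [|m IHm] X h x X_fg X_ind; first by exists h.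
move=> [Z [g [h' [Z_fg g_rad h'm hE]]]] hx.
have h'gx : h' (g x) <> 0 by rewrite hE in hx.
have [Y [i [p [indY ipK h'ip]]]] := ind_component ind_reps Z_fg h'gx.
have [Y_fg Y_ind] := ind_fg_ind _ indY.
have h'im := @rad_pow_comp m.+1 _ _ _ _ i h'm.
have [u um upgx] := IHm Y (h' \o i) (p (g x)) Y_fg Y_ind h'im h'ip.
exists (u \o (p \o g)) => //; exists Y, (p \o g), u; split=> //.
  by split=> //; exact: indC (h' \o i) _ indY h'ip.
move=> /linear_inverse[q [qK Kq]].
apply: (rad_not_retract (p := q \o p) X_fg X_ind g_rad).
by exists id => y; [exact: qK|exact: qK].
Qed.

(** Members of [ind] with a nonzero map to [C] lie in finitely many finite blocks, so their
    dimensions are bounded and [harada_sai] applies. *)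
Lemma rad_infty_vanish C X (h : {linear X -> C}) :
  fin_gen C -> fin_gen X ->
  (forall Y (g : {linear Y -> C}) y, P Infty Y -> g y = 0) ->
  (forall m, rad_pow m.+1 h) -> forall x, h x = 0.
Proof.
move=> C_fg X_fg Pinf0 h_rad x; apply: contrapT => hx.
have [ind_fg_ind _ _] := ind_reps; have [indP _ _] := P_part.
have [n tail0] := tail_maps_vanish C_fg Pinf0.
have [b bP] := blocks_bounded n.
have indC Y (g : {linear Y -> C}) y : ind Y -> g y <> 0 -> dim_le Y b.
  move=> /(indP Y)[[j|] PY] gy; last by case: gy; exact: Pinf0.
  case: (ltnP j n) => [lt_jn|le_nj]; first exact: bP PY.
  by case: gy; apply: tail0; exists (Fin j).
have [Y [i [p [indY ipK hip]]]] := ind_component ind_reps X_fg hx.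
have [Y_fg Y_ind] := ind_fg_ind _ indY.
have [m hs] := harada_sai b.
have [g gm gpx] :=
  @rad_pow_npath C b m Y (h \o i) (p x) indC Y_fg Y_ind (rad_pow_comp i (h_rad m)) hip.
apply: gpx; apply: hs gm _; split=> //.
exact: indC (h \o i) _ indY hip.
Qed.

End Partition.

End Dimension.

(** * The projection onto the cokernel *)

Section Projection.
Variables (A : pzRingType) (M N : lmodType A) (f : {linear M -> N}).

(** As with [incl], a sigma type hides the construction and leaves only the characteristic
    properties. *)
Lemma pi_subproof :
  {p : {linear N -> coker f} | surjective p /\ forall x, p x = 0 <-> exists y, f y = x}.
Proof.
have pi_lin : linear (fun x : N => \pi_(coker f) x : coker f).
  by move=> a u v; rewrite raddfD; congr (_ + _); exact/esym/pi_coker_scale.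
exists (mklin pi_lin); split=> [y|x]; first by exists (repr y); exact: reprK.
have -> : (mklin pi_lin x = 0) = (\pi_(coker f) x = \pi_(coker f) 0).
  by rewrite raddf0.
split=> [/eqP|fx]; last apply/eqP.
  by rewrite -Quotient.idealrBE subr0 => /asboolP.
by rewrite -Quotient.idealrBE subr0; apply/asboolP.
Qed.

Definition projection := sval pi_subproof.

Lemma projection_surj : surjective projection.
Proof. exact: (svalP pi_subproof).1. Qed.

Lemma projectionP x : projection x = 0 <-> exists y, f y = x.
Proof. exact: (svalP pi_subproof).2. Qed.

Lemma projectionK x : projection (f x) = 0.
Proof. by apply/projectionP; exists x. Qed.

End Projection.

Lemma in_add (A : pzRingType) (D : modclass A) (s : seq (lmodType A)) (M : lmodType A) :
  (forall X, List.In X s -> D X) -> iso M (direct_sum s) -> add D M.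
Proof.
move=> sD Ms; exists s; split=> //; exists (direct_sum [::]).
exact: iso_trans (iso_prod0 M (@is_zero_direct_sum_nil A)) Ms.
Qed.

Lemma trace_eq0 (A : pzRingType) (D : modclass A) (M : lmodType A) :
  trace D M =i pred1 0 ->
  forall (X : lmodType A) (h : {linear X -> M}) x, D X -> h x = 0.
Proof.
move=> tr0 X h x DX; apply/eqP.
have : h x \in trace D M by apply/asboolP => U; apply.
by rewrite tr0.
Qed.

(** * Cokernels of irreducible monomorphisms *)

Section IrreducibleMono.
Variables (k : fieldType) (A : falgType k).
Variables (M N : lmodType A) (f : {linear M -> N}).
Implicit Types L X Y : lmodType A.
Hypotheses (N_fg : fin_gen N) (f_irr : irreducible_morphism f).
Hypothesis f_inj : injective f.

Let pi := projection f.

(* Auslander-Reiten: [f] factors as [M -> V -> N] with [V] the preimage of the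
   image of [u]; the inclusion of [V] is not a split epimorphism, so [M]
   splits off [V]. *)
Lemma irreducible_mono_lift L (u : {linear L -> coker f}) :
  ~ surjective u -> exists v : {linear L -> N}, forall x, pi (v x) = u x.
Proof.
move=> u_nsurj; have [_ _ f_fact] := f_irr.
pose S y := exists x, u x = pi y.
have S0 : S 0 by exists 0; rewrite !linear0.
have SP a y z : S y -> S z -> S (a *: y + z).
  by move=> [x ux] [x' ux']; exists (a *: x + x'); rewrite !linearP ux ux'.
pose V := mksub S0 SP.
have [|g gE] := @corestrict _ _ V _ f.
  by move=> x; apply/mksubE; exists 0; rewrite linear0 /pi projectionK.
case: (f_fact _ g incl) => [|x|[r gK]|[s sK]].
- exact: fin_gen_inj N_fg (@incl_inj _ _ V).
- by rewrite /= gE.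
(* Elements of [V] with the same projection differ by some [g x], and [r] retracts [g]. Hence the
   lift built from the choice [w] is linear although [w] need not be. *)
- have r_pi (y z : submod V) : pi (incl y) = pi (incl z) ->
      incl y - f (r y) = incl z - f (r z).
    move=> yz; have /projectionP[x fx] : pi (incl (y - z)) = 0.
      by rewrite !linearB yz subrr.
    have yzE : y - z = g x by apply: incl_inj; rewrite gE.
    rewrite -(subrK z y) yzE !linearD gK gE.
    by rewrite addrACA subrr add0r.
  have /choice[w wE] x : exists y : submod V, pi (incl y) = u x.
    have [y yE] := projection_surj (u x).
    have yV : y \in V by apply/mksubE; exists x; rewrite -yE.
    by exists (Sub y yV); rewrite inclE SubK.
  have v_lin : linear (fun x => incl (w x) - f (r (w x))).
    move=> a x y.
    rewrite (r_pi (w (a *: x + y)) (a *: w x + w y)).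
      by rewrite !linearP scalerDr addrACA.
    by rewrite !linearP !wE linearP.
  exists (mklin v_lin) => x /=.
  by rewrite linearB {2}/pi projectionK subr0 wE.
(* A section of the inclusion makes [V] all of [N], so [u] would be surjective. *)
- case: u_nsurj => y; have [z <-] := projection_surj y.
  by have /mksubE[x ux] := incl_in (s z); exists x; rewrite ux sK.
Qed.

(** [x - s (pi x)] lies in the kernel of [pi], which is the image of [f]; this gives a retraction of
    [f]. *)
Lemma projection_no_section (s : {linear coker f -> N}) :
  ~ forall x, pi (s x) = x.
Proof.
move=> sK; have [f_nsplit _ _] := f_irr; apply: f_nsplit.
have /choice[r rE] x : exists y, f y = x - s (pi x).
  by apply/projectionP; rewrite linearB -/pi sK subrr.
have r_lin : linear r.
  move=> a x y; apply: f_inj; rewrite linearP !rE.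
  by rewrite !linearP scalerDr addrACA.
exists (mklin r_lin) => x; apply: f_inj.
by rewrite [LHS]rE /pi projectionK linear0 subr0.
Qed.

Lemma coker_nonzero : ~ is_zero (coker f).
Proof.
by move=> C0; apply: (@projection_no_section \0) => x; rewrite (C0 x) linear0.
Qed.

(** If both factors were nonzero, neither would surject onto the cokernel; both would lift to [N],
    and the lifts would add up to a section of [pi]. *)
Lemma coker_indecomposable : indecomposable (coker f).
Proof.
split=> [|X Y [h /linear_inverse[g [hK gK]]]]; first exact: coker_nonzero.
apply: contrapT => /not_orP[Xn0 Yn0].
have [|v vE] := @irreducible_mono_lift _ (g \o lin_inl X Y).
  move=> g_surj; apply: Yn0 => y; have [x gx] := g_surj (g (0, y)).
  by have /(congr1 snd) /= <- := can_inj gK gx.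
have [|w wE] := @irreducible_mono_lift _ (g \o lin_inr X Y).
  move=> g_surj; apply: Xn0 => x; have [y gy] := g_surj (g (x, 0)).
  by have /(congr1 fst) /= <- := can_inj gK gy.
apply: (@projection_no_section (lin_copair v w \o h)) => x /=.
by rewrite linearD vE wE /= -linearD -(pair_inlD (h x)) hK.
Qed.

(** If [g \o pi \o h] had an inverse [q], then [pi \o h \o q] would be a section of [g], hence
    bijective by indecomposability, and [pi] would have a section. *)
Lemma projection_rad : rad pi.
Proof.
move=> L h g L_fg [L_n0 _] /linear_inverse[q [qK Kq]].
have g_bij : bijective (pi \o (h \o q)).
  apply: (@indecomposable_split _ _ _ _ g coker_indecomposable L_n0).
  by move=> y; exact: Kq.
have [e [eK Ke]] := linear_inverse g_bij.
by apply: (@projection_no_section (h \o (q \o e))) => x; exact: Ke.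
Qed.

(** If the powers stopped at [n.+1], then [pi] itself would witness right degree condition [n.+1],
    since [pi \o f] is zero. The condition needs a positive exponent, so the first power is proved
    separately. *)
Lemma projection_rad_infty :
  right_degree f = Infty -> forall n, rad_pow n.+1 pi.
Proof.
move=> f_deg; elim=> [|n IHn]; first exact: projection_rad.
have no_deg m : ~ right_degree_cond f m.
  move: f_deg; rewrite /right_degree; case: pselect => // no_deg _ fm.
  by apply: no_deg; exists m; apply/asboolP.
apply: contrapT => pi_n; apply: (no_deg n.+1); split=> //.
have C_fg : fin_gen (coker f) by exact: fin_gen_surj N_fg (@projection_surj _ _ _ f).
exists (coker f), pi; split=> //; first exact: coker_indecomposable.
by apply: rad_pow0 => // x; exact: projectionK.
Qed.

End IrreducibleMono.

Theorem theorem3p4 (k : closedFieldType) (A : falgType k) (hA : basic A)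
    (ind : modclass A) (hind : ind_representatives ind)
    (P : natinf -> modclass A) (hP : postprojective_partition ind P)
    (M N : lmodType A) (hM : fin_gen M) (hN : fin_gen N)
    (f : {linear M -> N}) (hf : irreducible_morphism f) (hinj : injective f)
    (htr : trace (P Infty) N =i pred1 0) :
  right_degree f = Infty -> Pinf_simple P (coker f).
Proof.
move=> f_deg; have [_ ind_iso _] := hind; have [indP P_disj _] := hP.
have N0 := trace_eq0 htr.
have C_fg : fin_gen (coker f) by exact: fin_gen_surj hN (@projection_surj _ _ _ f).
have C_ind := coker_indecomposable hN hf hinj.
have lift := irreducible_mono_lift hN hf.
split=> [//||U [x0 x0U x0n0] [x1 x1U]].
  have [X indX CX] := ind_iso _ C_fg C_ind.
  exists X => //; have [[n|] PX //] := (indP X).1 indX.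
  (* Suppose [X] is in a finite block. Nonsurjective maps lift to [N], where the trace is zero; a
     surjective one would generate [X] from the rest of its tail. *)
  have Pinf0 (Y : lmodType A) (h : {linear Y -> coker f}) y : P Infty Y -> h y = 0.
    move=> PY; case: (pselect (surjective h)) => [h_surj|h_nsurj]; last first.
      have [v vE] := lift _ _ h_nsurj.
      by rewrite -vE (N0 _ v) // linear0.
    case: CX => c /bij_surj c_surj.
    case: (block_not_tr hind hP PX) => x.
    have [z <-] := c_surj x; have [y' <-] := h_surj z.
    apply: (@tr_gen _ _ _ _ (c \o h)); split; first by exists Infty.
    by move=> YX; subst Y; have := P_disj _ _ _ PX PY.
  case: (coker_nonzero hf hinj) => z; have [y <-] := projection_surj z.
  apply: (rad_infty_vanish hind hP C_fg hN Pinf0).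
  exact: projection_rad_infty.
(* As [U] is proper, its inclusion lifts to [N]. *)
have [|v vE] := lift _ (@incl _ _ U).
  by move=> U_surj; have [u ux1] := U_surj x1; move: x1U; rewrite -ux1 incl_in.
have U_fg : fin_gen (submod U) by exact: fin_gen_inj C_fg (@incl_inj _ _ U).
have [s [s_ind Us]] := ind_decomposition hind U_fg.
apply: (in_add _ Us) => X Xs; have indX := s_ind X Xs.
have [[n|] PX] := (indP X).1 indX; first by exists n.
have [ind_fg_ind _ _] := hind; have [_ [X_n0 _]] := ind_fg_ind _ indX.
have [i [p ipK]] := direct_sum_retract Xs.
case: Us => c /linear_inverse[d [cK dK]].
(* A summand in [P Infty] is killed by [v], hence by the inclusion, which is [v] followed by the
   projection; so it is zero. *)
case: X_n0 => x; rewrite -[x]ipK -[i x]dK.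
rewrite (_ : d (i x) = 0) ?linear0 //; apply: incl_inj.
have v0 : v (d (i x)) = 0 := N0 _ (v \o (d \o i)) x PX.
by rewrite linear0 -vE v0 linear0.
Qed.
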